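(* Let $\mathcal{X}\subseteq\mathbb{R}^n$ be a nonempty convex polyhedron, $a_0\in\mathbb{R}^n$, and let $\varphi(\cdot)=g(\|\cdot\|_{\mathcal{V}^{\circ}})$, where $\mathcal{V}\subset\mathbb{R}^n$ is compact, smooth and strictly convex with $0\in\mathrm{int}(\mathcal{V})$ and $g:\mathbb{R}\to[0,\infty)$ is Legendre with $g(0)=0$ and $g'(0)=0$. Let $x_0\in\mathcal{X}$, let $\{x_k\}$ be the proximal path induced by $\varphi$, initialized at $x_0$ and associated with a step-size sequence $\{\lambda_k>0\}$ with $\sum_{k=0}^{\infty}\lambda_k^{-1}=\infty$, and let $x_{\mathrm{CP}}(\omega)$ be the central path induced by $\varphi$ and also initialized at $x_0$. Let $K\ge1$ be an integer. If any of the following conditions is satisfied: (C1, Monotone) $\{x_k\}$ is monotone on $\mathcal{X}$; (C2, Affine subspace) $\mathcal{X}=\{x\in\mathbb{R}^n:Ax=b\}$; (C3, Unconstrained) $\mathcal{X}=\mathbb{R}^n$; then $x_{k+1}=x_{\mathrm{CP}}(\omega_{k+1})$ for all $k\in\{0,1,\dots,K\}$, where $\omega_k=\left(\lambda_0^{-1}+\dots+\lambda_{k-1}^{-1}\right)^{-1}$ for $k\ge1$.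
   Context: For a closed convex set $\mathcal{C}\subseteq\mathbb{R}^n$ containing $0$: the gauge is $\|v\|_{\mathcal{C}}=\inf\{t\ge0: v\in t\mathcal{C}\}$ and the polar is $\mathcal{C}^{\circ}=\{y:\langle x,y\rangle\le1\ \forall x\in\mathcal{C}\}$. A convex set with nonempty interior is strictly convex if for distinct boundary points the open segment between them lies in the interior; it is smooth if the supporting hyperplane at each boundary point is unique. A proper closed convex function $\psi:\mathbb{R}^n\to\mathbb{R}\cup\{+\infty\}$ is Legendre if $\mathrm{int}(\mathrm{dom}\,\psi)\ne\varnothing$, $\psi$ is differentiable and strictly convex on $\mathrm{int}(\mathrm{dom}\,\psi)$, and $\|\nabla\psi(x_n)\|_2\to\infty$ whenever $x_n\in\mathrm{int}(\mathrm{dom}\,\psi)$ converges to a boundary point of $\mathrm{dom}\,\psi$. Bregman divergence: $D_\varphi(x,y)=\varphi(x)-\varphi(y)-\langle\nabla\varphi(y),x-y\rangle$. Proximal path: $x_{k+1}=\arg\min_{x\in\mathcal{X}}\langle a_0,x\rangle+\lambda_kD_\varphi(x,x_k)$, $k=0,1,\dots$. Central path initialized at $x_0$: $x_{\mathrm{CP}}(\omega)=\arg\min_{x\in\mathcal{X}}\langle a_0,x\rangle+\omega D_\varphi(x,x_0)$. These minimizers are taken to exist (they are then unique by strict convexity). The proximal path is monotone on the convex polyhedron $\mathcal{X}$ if for every face $\mathcal{F}$ of $\mathcal{X}$ and every $k\ge0$: $x_k\in\mathcal{F}$ implies $x_{k+n}\in\mathcal{F}$ for all $n\in\{1,\dots,K\}$.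 *)

(* Defs.v *)
From HB Require Import structures.
From mathcomp Require Export all_boot all_order all_algebra.
From mathcomp Require Export all_classical all_reals all_analysis.
Set Implicit Arguments.
Unset Strict Implicit.
Unset Printing Implicit Defensive.
Import Order.TTheory GRing.Theory Num.Theory.
Import numFieldNormedType.Exports.
Local Open Scope classical_set_scope.
Local Open Scope ring_scope.

(* R^n is 'rV[R]_n. Its library norm is the max norm; it is only used for the
   topology, the Euclidean norm being [norm2] below. *)

Definition dot (R : realType) (n : nat) (x y : 'rV[R]_n) : R :=
  \sum_(i < n) x ord0 i * y ord0 i.

Definition norm2 (R : realType) (n : nat) (x : 'rV[R]_n) : R :=
  Num.sqrt (dot x x).

Definition gradient (R : realType) (n : nat) (f : 'rV[R]_n -> R)
    (x : 'rV[R]_n) : 'rV[R]_n :=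
  \row_(i < n) 'D_(delta_mx ord0 i) f x.

Definition boundary (T : topologicalType) (A : set T) : set T :=
  closure A `\` A°.

(* The infimum over an empty set is +oo. *)
Definition set_gauge (R : realType) (n : nat) (C : set 'rV[R]_n)
    (v : 'rV[R]_n) : \bar R :=
  ereal_inf [set t%:E | t in [set t : R | 0 <= t /\ [set t *: u | u in C] v]].

Definition polar (R : realType) (n : nat) (C : set 'rV[R]_n) : set 'rV[R]_n :=
  [set y | forall x, C x -> dot x y <= 1].

Definition strictly_convex_set (R : realType) (n : nat)
    (C : set 'rV[R]_n) : Prop :=
  [/\ convex_set C, C° !=set0 &
      forall x y, boundary C x -> boundary C y -> x != y ->
        forall t : R, 0 < t < 1 -> C° (t *: x + (1 - t) *: y)].

Definition supporting_hyperplane (R : realType) (n : nat) (C : set 'rV[R]_n)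
    (x : 'rV[R]_n) (H : set 'rV[R]_n) : Prop :=
  exists u : 'rV[R]_n,
    [/\ u != 0, H = [set y | dot u y = dot u x] &
        forall y, C y -> dot u y <= dot u x].

Definition smooth_set (R : realType) (n : nat) (C : set 'rV[R]_n) : Prop :=
  [/\ convex_set C, C° !=set0 &
      forall x, boundary C x -> exists! H, supporting_hyperplane C x H].

Definition edom (R : realType) (n : nat) (psi : 'rV[R]_n -> \bar R) :
    set 'rV[R]_n :=
  [set x | (psi x < +oo)%E].

Definition proper_fun (R : realType) (n : nat)
    (psi : 'rV[R]_n -> \bar R) : Prop :=
  (forall x, (-oo < psi x)%E) /\ edom psi !=set0.

Definition closed_fun (R : realType) (n : nat)
    (psi : 'rV[R]_n -> \bar R) : Prop :=
  closed [set p : 'rV[R]_n * R | (psi p.1 <= p.2%:E)%E].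

Definition convex_fun (R : realType) (n : nat)
    (psi : 'rV[R]_n -> \bar R) : Prop :=
  forall (x y : 'rV[R]_n) (t : R), 0 <= t <= 1 ->
    (psi (t *: x + (1 - t) *: y)%R <= t%:E * psi x + (1 - t)%:E * psi y)%E.

Definition strictly_convex_on (R : realType) (n : nat) (A : set 'rV[R]_n)
    (psi : 'rV[R]_n -> \bar R) : Prop :=
  forall x y : 'rV[R]_n, A x -> A y -> x != y -> forall t : R, 0 < t < 1 ->
    (psi (t *: x + (1 - t) *: y)%R < t%:E * psi x + (1 - t)%:E * psi y)%E.

(* [fine \o psi] is the real-valued function that agrees with psi on its
   domain; derivatives are only taken in the interior of that domain. *)
Definition legendre (R : realType) (n : nat)
    (psi : 'rV[R]_n -> \bar R) : Prop :=
  [/\ proper_fun psi, closed_fun psi & convex_fun psi] /\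
  [/\ (edom psi)° !=set0,
      forall x, (edom psi)° x -> differentiable (fine \o psi) x,
      strictly_convex_on (edom psi)° psi &
      forall (u : nat -> 'rV[R]_n) (x : 'rV[R]_n),
        (forall k, (edom psi)° (u k)) -> boundary (edom psi) x ->
        u @ \oo --> x ->
        (fun k => norm2 (gradient (fine \o psi) (u k))) @ \oo --> +oo].

Definition bregman (R : realType) (n : nat) (phi : 'rV[R]_n -> R)
    (x y : 'rV[R]_n) : R :=
  phi x - phi y - dot (gradient phi y) (x - y).

Definition is_argmin (R : realType) (n : nat) (X : set 'rV[R]_n)
    (f : 'rV[R]_n -> R) (x : 'rV[R]_n) : Prop :=
  X x /\ forall y, X y -> f x <= f y.

Definition proximal_path (R : realType) (n : nat) (X : set 'rV[R]_n)
    (a0 : 'rV[R]_n) (phi : 'rV[R]_n -> R) (lambda : nat -> R)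
    (x0 : 'rV[R]_n) (x : nat -> 'rV[R]_n) : Prop :=
  x 0%N = x0 /\
  forall k : nat,
    is_argmin X (fun y => dot a0 y + lambda k * bregman phi y (x k)) (x k.+1).

Definition central_path (R : realType) (n : nat) (X : set 'rV[R]_n)
    (a0 : 'rV[R]_n) (phi : 'rV[R]_n -> R) (x0 : 'rV[R]_n)
    (xCP : R -> 'rV[R]_n) : Prop :=
  forall omega : R, 0 < omega ->
    is_argmin X (fun y => dot a0 y + omega * bregman phi y x0) (xCP omega).

Definition polyhedron (R : realType) (n : nat) (X : set 'rV[R]_n) : Prop :=
  exists (m : nat) (A : 'M[R]_(m, n)) (b : 'I_m -> R),
    X = [set x | forall i : 'I_m, dot (row i A) x <= b i].

Definition affine_subspace (R : realType) (n : nat) (X : set 'rV[R]_n) : Prop :=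
  exists (m : nat) (A : 'M[R]_(m, n)) (b : 'I_m -> R),
    X = [set x | forall i : 'I_m, dot (row i A) x = b i].

(* A face is cut out of X by a valid inequality; u = 0 makes X itself (c = 0)
   and the empty set (c > 0) faces. *)
Definition face (R : realType) (n : nat) (X F : set 'rV[R]_n) : Prop :=
  exists (u : 'rV[R]_n) (c : R),
    (forall x, X x -> dot u x <= c) /\ F = X `&` [set x | dot u x = c].

Definition monotone_path (R : realType) (n : nat) (X : set 'rV[R]_n)
    (K : nat) (x : nat -> 'rV[R]_n) : Prop :=
  forall F, face X F -> forall k : nat, F (x k) ->
    forall j : nat, (1 <= j <= K)%N -> F (x (k + j)%N).

(* Main.v *)
Require Import Defs.
From mathcomp Require Import ring lra.
Set Implicit Arguments.
Unset Strict Implicit.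
Unset Printing Implicit Defensive.
Import Order.TTheory GRing.Theory Num.Theory.
Import numFieldNormedType.Exports.
Local Open Scope classical_set_scope.
Local Open Scope ring_scope.

(** The gauge of the polar of V is the support function h of V, so the
    potential is phi = g o h (lemma [set_gauge_polar]).  The geometry of V
    supplies the two properties of phi that the optimization argument needs.

    - Differentiability along every line ([gauge_potential_gateaux]).  Strict
      convexity of V makes the maximizer v of a nonzero linear form y over V
      unique, and then, by Danskin's argument, h has derivative <v, d> at y
      along d ([support_fun_is_derive]).  At the origin h has a kink, which
      g'(0) = 0 flattens.

    - Strict convexity ([gauge_potential_strictly_convex]).  Strict convexity
      of g handles two points with h x != h y.  If h x = h y and h is affine
      between x and y, then a maximizer v at an intermediate point maximizes
      both x and y over V, so x and y define two supporting hyperplanes of V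
      at v; these agree because V is smooth, whence x = y
      ([smooth_common_maximizer]).

    Write G for the gradient of phi.  The first-order condition for the i-th
    proximal step says that n_i = a0 + lambda_i (G(x_{i+1}) - G(x_i)) satisfies
    <n_i, y - x_{i+1}> >= 0 for y in X, that is, -n_i is normal to X at x_{i+1}.
    The points of X where equality holds form a face containing x_{i+1}; on a
    monotone path the later iterates stay in it, so -n_i is still normal to X
    at x_{k+1} ([prox_normal_stays]).  The G-terms of the combination with
    weights 1 / lambda_i telescope: omega_{k+1} times the sum of n_i / lambda_i
    over i <= k is a0 + omega_{k+1} (G(x_{k+1}) - G(x_0)) ([sum_prox_normal]),
    which is the first-order condition for x_{k+1} to minimize the objective
    that defines the central path at omega_{k+1}.  That minimizer is unique.

    An affine subspace, the whole space included, has no nonempty face but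
    itself, so every path in it is monotone ([affine_monotone]). *)

(** * The Euclidean inner product *)

Section Dot.
Context {R : realType} {n : nat}.
Implicit Types (x y z : 'rV[R]_n) (t : R).

Lemma dotC x y : dot x y = dot y x.
Proof. by apply: eq_bigr => i _; rewrite mulrC. Qed.

Lemma dotDl x y z : dot (x + y) z = dot x z + dot y z.
Proof. by rewrite /dot -big_split/=; apply: eq_bigr => i _; rewrite mxE mulrDl. Qed.

Lemma dotZl t x z : dot (t *: x) z = t * dot x z.
Proof. by rewrite /dot mulr_sumr; apply: eq_bigr => i _; rewrite mxE mulrA. Qed.

Lemma dotNl x z : dot (- x) z = - dot x z.
Proof. by rewrite -scaleN1r dotZl mulN1r. Qed.

Lemma dotBl x y z : dot (x - y) z = dot x z - dot y z.
Proof. by rewrite dotDl dotNl. Qed.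

Lemma dot0l z : dot 0 z = 0.
Proof. by rewrite -(scale0r 0) dotZl mul0r. Qed.

Lemma dotDr x y z : dot z (x + y) = dot z x + dot z y.
Proof. by rewrite !(dotC z) dotDl. Qed.

Lemma dotZr t x z : dot z (t *: x) = t * dot z x.
Proof. by rewrite !(dotC z) dotZl. Qed.

Lemma dotNr x z : dot z (- x) = - dot z x.
Proof. by rewrite !(dotC z) dotNl. Qed.

Lemma dotBr x y z : dot z (x - y) = dot z x - dot z y.
Proof. by rewrite dotDr dotNr. Qed.

Lemma dot_suml (I : Type) (r : seq I) (F : I -> 'rV[R]_n) z :
  dot (\sum_(i <- r) F i) z = \sum_(i <- r) dot (F i) z.
Proof. by elim/big_rec2: _ => [|i u v _ <-]; rewrite ?dot0l ?dotDl. Qed.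

Definition dotE := (dotDl, dotZl, dotNl, dotDr, dotZr, dotNr).

Lemma dot_delta x i : dot x (delta_mx ord0 i) = x ord0 i.
Proof.
rewrite /dot (bigD1 i)//= big1 ?addr0 => [|j /negPf ji].
  by rewrite mxE !eqxx mulr1.
by rewrite mxE eqxx ji mulr0.
Qed.

Lemma dot_gt0 x : x != 0 -> 0 < dot x x.
Proof.
move=> x0; have ge i : 0 <= x ord0 i * x ord0 i by rewrite -expr2 sqr_ge0.
rewrite lt_def sumr_ge0// andbT; apply: contra x0 => /eqP/psumr_eq0P H.
apply/eqP/rowP => i; rewrite mxE; apply/eqP.
by move: (H (fun j _ => ge j) i isT) => /eqP; rewrite mulf_eq0 orbb.
Qed.

Lemma dot_continuous y : continuous (fun x => dot x y).
Proof.
apply: (continuous_big add_continuous) => i _ x.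
have H := @coord_continuous R 1 n ord0 i x.
exact: (cvgM H (cvg_cst (y ord0 i))).
Qed.

End Dot.

(** * Directional derivatives *)

Section DirectionalDerivatives.
Context {R : realType} {W : normedModType R}.
Implicit Types (f : W -> R) (x d : W) (l c : R).

(** The first-order expansion along a line, free of quotients and filters:
    the estimates below for support functions take this form directly. *)
Lemma is_derive_epsP f x d l :
  is_derive x d f l <->
  (forall e, 0 < e -> exists2 r, 0 < r &
    forall t, `|t| < r -> `|f (x + t *: d) - f x - t * l| <= e * `|t|).
Proof.
pose q t := t^-1 *: (f (t *: d + x) - f x).
have qE t : t != 0 ->
    `|f (x + t *: d) - f x - t * l| = `|l - q t| * `|t|.
  move=> t0; rewrite -normrM distrC /q [x + _]addrC; congr `|_|.
  by rewrite /GRing.scale/=; field.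
have -> : is_derive x d f l <-> q @ 0^' --> l.
  split=> [[dfx <-]//|ql]; split; first by apply/cvg_ex; exists l.
  exact: cvg_lim ql.
split=> [/cvgrPdist_le H e e0|H].
  have [r /= r0 {}H] := H e e0; exists r => // t tr.
  have [->|t0] := eqVneq t 0.
    by rewrite scale0r addr0 subrr mul0r subrr !normr0 mulr0.
  rewrite qE// ler_wpM2r//; apply: H => //=.
  by rewrite /ball_ /= sub0r normrN.
apply/cvgrPdist_le => e e0; have [r r0 {}H] := H e e0.
exists r => //= t; rewrite /ball_/= sub0r normrN => tr t0.
by have := H t tr; rewrite qE// ler_pM2r// normr_gt0.
Qed.

End DirectionalDerivatives.

Section Lines.
Context {R : realType} {W : normedModType R}.
Implicit Types (f : W -> R) (x d : W) (l c : R).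

Lemma is_derive_lineP f x d l :
  is_derive x d f l <-> is_derive (0 : R) (1 : R) (fun t => f (x + t *: d)) l.
Proof.
rewrite is_derive_epsP.
split.
  move=> H; apply/is_derive_epsP => e /H[r r0 {}H]; exists r => // t /H.
  by rewrite scale0r addr0 add0r [t *: 1]mulr1.
move=> /is_derive_epsP H e /H[r r0 {}H]; exists r => // t /H.
by rewrite scale0r addr0 add0r [t *: 1]mulr1.
Qed.

(** One-sided bounds on difference quotients pass to the derivative; this
    yields both the gradient inequality for convex functions and the
    first-order condition for minimizers. *)
Lemma derive_le_slope f x d l c : is_derive x d f l ->
  (forall t, 0 < t <= 1 -> f (x + t *: d) - f x <= t * c) -> l <= c.
Proof.
move=> /is_derive_epsP H fc; apply/ler_addgt0Pr => e e0.
have [r r0 {}H] := H e e0.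
pose t := Num.min (r / 2) 1.
have t0 : 0 < t by rewrite lt_min ltr01 divr_gt0.
have t1 : t <= 1 by rewrite ge_min lexx orbT.
have tr : `|t| < r.
  rewrite gtr0_norm// /t gt_min; apply/orP; left; lra.
have := H _ tr; rewrite ler_norml (gtr0_norm t0) => /andP[He _].
have := fc t; rewrite t0 t1 => /(_ isT) Hc.
rewrite -(ler_pM2l t0); lra.
Qed.

Lemma is_derive_real_comp (g : R -> R) f x d l :
  derivable g (f x) 1 -> is_derive x d f l ->
  is_derive x d (g \o f) (derive1 g (f x) * l).
Proof.
move=> dg /is_derive_lineP[df <-]; apply/is_derive_lineP.
have fx : (fun t => f (x + t *: d)) 0 = f x by rewrite scale0r addr0.
rewrite -fx in dg *; split.
  apply/derivable1_diffP; move: df dg => /derivable1_diffP df /derivable1_diffP.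
  exact: differentiable_comp df.
by rewrite -!derive1E (derive1_comp df dg).
Qed.

End Lines.

(** [gradient f] is the row of partial derivatives; here it is required to
    represent the derivatives along all directions. *)
Definition gateaux (R : realType) (n : nat) (f : 'rV[R]_n -> R) :=
  forall x d, is_derive x d f (dot (gradient f x) d).

Lemma gateauxP (R : realType) (n : nat) (f : 'rV[R]_n -> R) :
  (forall x, exists p, forall d, is_derive x d f (dot p d)) -> gateaux f.
Proof.
move=> H x d; have [p px] := H x.
suff -> : gradient f x = p by [].
apply/rowP => i; rewrite mxE.
by have [_ ->] := px (delta_mx ord0 i); rewrite dot_delta.
Qed.

(** * Convexity *)

Definition strictly_convex (R : realType) (W : lmodType R) (f : W -> R) :=
  forall x y, x != y -> forall t, 0 < t < 1 ->
    f (t *: x + (1 - t) *: y) < t * f x + (1 - t) * f y.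

Section ConvexSets.
Context {R : realType} {n : nat}.
Implicit Types (X : set 'rV[R]_n) (x y : 'rV[R]_n).

Lemma segmentE x y (t : R) : t *: x + (1 - t) *: y = y + t *: (x - y).
Proof. by rewrite scalerBl scalerBr scale1r addrCA. Qed.

Lemma convex_set_segment X x y t : convex_set X ->
  X x -> X y -> 0 <= t <= 1 -> X (x + t *: (y - x)).
Proof.
move=> convX Xx Xy /andP[t0 t1].
have := convX _ _ (Itv01 t0 t1) (mem_set Xy) (mem_set Xx).
by move/set_mem; congr X; rewrite /conv/=; exact: segmentE.
Qed.

End ConvexSets.

Section Polyhedra.
Context {R : realType} {n : nat}.
Implicit Types (X : set 'rV[R]_n).

Lemma polyhedron_convex X : polyhedron X -> convex_set X.
Proof.
move=> [m [A [b ->]]] x y t /set_mem Xx /set_mem Xy; apply/mem_set => i.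
rewrite /conv/= dotDr !dotZr /unstable.onem.
have t0 : 0 <= t%:num by [].
have t1 : t%:num <= 1 by [].
have /= := ler_wpM2l t0 (Xx i).
have /= := @ler_wpM2l _ (1 - t%:num) _ _ _ (Xy i).
rewrite subr_ge0 t1 => /(_ isT); lra.
Qed.

(** A linear form bounded above by its value at a point [x k] of an affine
    subspace is constant on it: the value at [x k] is the mean of the values at
    any other point and at its reflection through [x k]. *)
Lemma affine_monotone X K x : affine_subspace X -> (forall k, X (x k)) ->
  monotone_path X K x.
Proof.
move=> [m [A [b XE]]] Xx F [u [c [uc ->]]] k [_ /= uk] j _.
split=> //=; apply/eqP; rewrite eq_le uc//=.
have : X (x k + (x k - x (k + j)%N)).
  move: (Xx k) (Xx (k + j)%N); rewrite XE/= => H1 H2 i.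
  by rewrite dotDr dotBr H1 H2; ring.
by move/uc; rewrite dotDr dotBr uk; lra.
Qed.

Lemma setT_affine : affine_subspace [set: 'rV[R]_n].
Proof.
by exists 0%N, 0, (fun=> 0); apply/seteqP; split=> // x _ [].
Qed.

End Polyhedra.

(** * Bregman proximal steps *)

Section BregmanProximal.
Context {R : realType} {n : nat}.
Variables (X : set 'rV[R]_n) (a0 : 'rV[R]_n) (phi : 'rV[R]_n -> R).
Hypotheses (convX : convex_set X) (cphi : strictly_convex phi).
Hypothesis dphi : gateaux phi.
Implicit Types (x y z : 'rV[R]_n) (c : R).

Local Notation grad := (gradient phi).
Local Notation objective c z := (fun y => dot a0 y + c * bregman phi y z).

Lemma gradient_ineq x y : phi x + dot (grad x) (y - x) <= phi y.
Proof.
suff : dot (grad x) (y - x) <= phi y - phi x by lra.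
apply: (derive_le_slope (dphi x (y - x))) => t /andP[t0 t1].
have [->|yx] := eqVneq y x; first by rewrite !subrr scaler0 addr0 subrr mulr0.
rewrite -segmentE.
move: t1; rewrite le_eqVlt => /predU1P[->|t1].
  by rewrite subrr scale0r addr0 scale1r mul1r.
have /(cphi yx)/ltW : 0 < t < 1 by rewrite t0.
lra.
Qed.

Lemma is_derive_objective c z x d : 0 < c ->
  is_derive x d (objective c z) (dot (a0 + c *: (grad x - grad z)) d).
Proof.
move=> c0; apply/is_derive_epsP => e e0.
have /is_derive_epsP/(_ (e / c))[|r r0 H] := dphi x d; first exact: divr_gt0.
exists r => // t /H; rewrite -(ler_pM2l c0) mulrA [c * (e / c)]mulrC divfK ?gt_eqF//.
rewrite -{1}(gtr0_norm c0) -normrM; apply: le_trans.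
by rewrite /bregman !dotE le_eqVlt; apply/orP; left; apply/eqP; congr `|_|; ring.
Qed.

Lemma argmin_variational c z x : 0 < c -> is_argmin X (objective c z) x ->
  forall y, X y -> 0 <= dot (a0 + c *: (grad x - grad z)) (y - x).
Proof.
move=> c0 [Xx xmin] y Xy.
have /is_derive_epsP D := is_derive_objective z x (y - x) c0.
have D' : is_derive x (y - x) (fun u => - (dot a0 u + c * bregman phi u z))
    (- dot (a0 + c *: (grad x - grad z)) (y - x)).
  apply/is_derive_epsP => e /D[r r0 H]; exists r => // t /H.
  by rewrite -normrN; congr (`|_| <= _); ring.
rewrite -oppr_le0; apply: (derive_le_slope D') => t /andP[t0 t1].
rewrite mulr0 opprK addrC subr_le0 xmin//.
by apply: convex_set_segment => //; rewrite ?(ltW t0).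
Qed.

Lemma variational_argmin c z x : 0 < c -> X x ->
  (forall y, X y -> 0 <= dot (a0 + c *: (grad x - grad z)) (y - x)) ->
  is_argmin X (objective c z) x.
Proof.
move=> c0 Xx H; split=> // y /H; rewrite -subr_ge0 => {}H.
have := gradient_ineq x y; rewrite -subr_ge0 -(pmulr_rge0 _ c0) => G.
rewrite -subr_ge0; apply: le_trans (addr_ge0 G H) _.
rewrite le_eqVlt; apply/orP; left; apply/eqP.
by rewrite /bregman !dotE; ring.
Qed.

Lemma argmin_unique c z x y : 0 < c ->
  is_argmin X (objective c z) x -> is_argmin X (objective c z) y -> x = y.
Proof.
move=> c0 [Xx xmin] [Xy ymin]; apply/eqP/negPn/negP => xy.
have h2 : 0 < (2^-1 : R) < 1 by lra.
have := cphi xy h2.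
have Xm : X (2^-1 *: x + (1 - 2^-1) *: y).
  by rewrite segmentE; apply: convex_set_segment => //; lra.
have := xmin _ Xm; have := ymin _ Xm.
rewrite -(ltr_pM2l c0) /bregman !dotE; lra.
Qed.

Section Path.
Variables (lambda : nat -> R) (x : nat -> 'rV[R]_n).
Hypothesis lambda_gt0 : forall k, 0 < lambda k.
Hypothesis prox : proximal_path X a0 phi lambda (x 0%N) x.

Local Notation omega k := (\sum_(0 <= i < k.+1) (lambda i)^-1)^-1.

Lemma omega_gt0 k : 0 < omega k.
Proof.
rewrite invr_gt0 big_nat_recr//= ltr_wpDl ?invr_gt0// sumr_ge0// => i _.
by rewrite invr_ge0 ltW.
Qed.

(** The gradient at the minimizer of the objective of the i-th step. *)
Definition prox_normal i := a0 + lambda i *: (grad (x i.+1) - grad (x i)).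

Lemma prox_normal_ge0 i y : X y -> 0 <= dot (prox_normal i) (y - x i.+1).
Proof. exact: argmin_variational (prox.2 i) _. Qed.

(** [- prox_normal i] is normal to X at the (i+1)-st iterate, and it exposes a
    face of X there.  Monotonicity keeps the later iterates in this face, where
    the same vector is normal. *)
Lemma prox_normal_stays K i k y : monotone_path X K x ->
  (i <= k)%N -> (k <= K)%N -> X y -> 0 <= dot (prox_normal i) (y - x k.+1).
Proof.
move=> mono ik kK Xy; have := prox_normal_ge0 i Xy.
move: ik; rewrite leq_eqVlt => /predU1P[->//|ik].
set v := prox_normal i => H.
have vF : face X (X `&` [set u | dot (- v) u = dot (- v) (x i.+1)]).
  exists (- v), (dot (- v) (x i.+1)); split=> // u /(prox_normal_ge0 i).
  by rewrite -/v dotBr !dotNl; lra.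
have := mono _ vF i.+1 (conj (prox.2 i).1 erefl) (k - i)%N.
rewrite subn_gt0 ik (leq_trans (leq_subr _ _) kK) addSn subnKC ?(ltnW ik)//.
move=> /(_ isT)[_ /=]; rewrite !dotNl => /oppr_inj E.
by move: H; rewrite !dotBr E.
Qed.

Lemma sum_prox_normal k :
  a0 + omega k *: (grad (x k.+1) - grad (x 0%N)) =
  omega k *: \sum_(0 <= i < k.+1) (lambda i)^-1 *: prox_normal i.
Proof.
have -> : \sum_(0 <= i < k.+1) (lambda i)^-1 *: prox_normal i =
    (omega k)^-1 *: a0 + (grad (x k.+1) - grad (x 0%N)).
  rewrite invrK scaler_suml -(telescope_sumr (fun i => grad (x i)))//.
  rewrite -big_split/=; apply: eq_bigr => i _.
  by rewrite /prox_normal scalerDr scalerA mulVf ?scale1r// gt_eqF.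
by rewrite [RHS]scalerDr scalerA mulfV ?scale1r// gt_eqF// omega_gt0.
Qed.

(** By [sum_prox_normal] the gradient at [x k.+1] of the central path objective
    is a positive combination of the [prox_normal i], each of which is
    nonnegative on the feasible directions there. *)
Theorem monotone_prox_central K k : monotone_path X K x -> (k <= K)%N ->
  is_argmin X (objective (omega k) (x 0%N)) (x k.+1).
Proof.
move=> mono kK; apply: variational_argmin; first exact: omega_gt0.
  exact: (prox.2 k).1.
move=> y Xy; rewrite sum_prox_normal dotZl dot_suml.
apply: mulr_ge0; first exact/ltW/omega_gt0.
rewrite big_nat_cond; apply: sumr_ge0 => i; rewrite andbT ltnS => ik.
rewrite dotZl mulr_ge0 ?invr_ge0 ?(ltW (lambda_gt0 _))//.
exact: prox_normal_stays mono ik kK Xy.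
Qed.

End Path.
End BregmanProximal.

(** * Support functions *)

Definition support_fun (R : realType) (n : nat) (V : set 'rV[R]_n)
    (y : 'rV[R]_n) : R := sup [set dot v y | v in V].

Section SupportFunction.
Context {R : realType} {n : nat} (V : set 'rV[R]_n).
Hypotheses (cV : compact V) (V0 : V° 0).
Implicit Types (v w x y z d : 'rV[R]_n).

Local Notation h := (support_fun V).

Lemma compact_dot_max (A : set 'rV[R]_n) y : compact A -> A !=set0 ->
  exists2 v, A v & forall w, A w -> dot w y <= dot v y.
Proof.
move=> cA A0.
have ct : {within A, continuous (fun v => dot v y)}.
  exact/continuous_subspaceT/dot_continuous.
have [v /set_mem Av H] := compact_EVT_max A0 cA ct.
by exists v => // w Aw; apply: H; exact/mem_set.
Qed.

Lemma support_fun_attained y :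
  exists2 v, V v & h y = dot v y /\ forall w, V w -> dot w y <= h y.
Proof.
have [v Vv vmax] := compact_dot_max y cV (ex_intro _ _ (interior_subset V0)).
suff hE : h y = dot v y by exists v => //; rewrite hE.
have ub : ubound [set dot w y | w in V] (dot v y) by move=> _ [w /vmax + <-].
apply/eqP; rewrite eq_le ge_sup//; last by exists (dot v y), v.
by apply: ub_le_sup; [exists (dot v y)|exists v].
Qed.

Lemma support_fun_ub v y : V v -> dot v y <= h y.
Proof. by move=> Vv; have [_ _ [_]] := support_fun_attained y; exact. Qed.

Lemma support_fun_le y c : (forall v, V v -> dot v y <= c) -> h y <= c.
Proof. by have [v Vv [-> _]] := support_fun_attained y; exact. Qed.

(** From an interior point one can still move a little in the direction y. *)
Lemma interior_dot_lt v y : V° v -> y != 0 -> dot v y < h y.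
Proof.
move=> Vv y0.
have : \forall t \near (0 : R), V (v + t *: y).
  have : (fun t : R => v + t *: y) @ 0 --> v + 0 *: y.
    by apply: cvgD; [exact: cvg_cst|apply: cvgZr_tmp; exact: cvg_id].
  by apply; rewrite scale0r addr0.
move=> /nbhs_ballP[r /= r0]; move/(_ (r / 2)).
rewrite /ball/= sub0r normrN gtr0_norm ?divr_gt0//.
have -> : r / 2 < r by lra.
move=> /(_ isT)/support_fun_ub => /(_ y); apply: lt_le_trans.
by rewrite dotDl dotZl ltrDl mulr_gt0 ?dot_gt0 ?divr_gt0.
Qed.

Lemma support_fun_gt0 y : y != 0 -> 0 < h y.
Proof. by move=> /(interior_dot_lt V0); rewrite dot0l. Qed.

Lemma support_fun0 : h 0 = 0.
Proof. by have [v _ [-> _]] := support_fun_attained 0; rewrite dotC dot0l. Qed.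

Lemma support_fun_eq0 y : h y = 0 -> y = 0.
Proof.
move=> hy; apply/eqP/negPn/negP => /support_fun_gt0.
by rewrite hy ltxx.
Qed.

Lemma support_fun_ge0 y : 0 <= h y.
Proof.
by have [->|/support_fun_gt0/ltW//] := eqVneq y 0; rewrite support_fun0.
Qed.

(** For t > 0 the point y lies in t times the polar iff <v, y> <= t for all v
    in V, that is, h y <= t; since h y > 0 for y nonzero, t = 0 is admissible
    only at 0. *)
Lemma set_gauge_polar y : set_gauge (polar V) y = (h y)%:E.
Proof.
have -> : set_gauge (polar V) y = ereal_inf [set t%:E | t in [set t | h y <= t]].
  congr (ereal_inf (_ @` _)); apply/seteqP; split=> t /=.
    move=> [t0 [u polu <-]]; apply: support_fun_le => v Vv.
    by rewrite dotZr ler_piMr// polu.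
  move=> hyt; have t0 := le_trans (support_fun_ge0 y) hyt; split=> //.
  have [y0|y0] := eqVneq y 0.
    exists 0; rewrite ?scaler0// => v _.
    by rewrite dotC dot0l ler01.
  have tgt0 := lt_le_trans (support_fun_gt0 y0) hyt.
  exists (t^-1 *: y); last by rewrite scalerA mulfV ?scale1r// gt_eqF.
  move=> v Vv; rewrite dotZr ler_pdivrMl// mulr1.
  exact: le_trans (support_fun_ub _ Vv) hyt.
apply/eqP; rewrite eq_le; apply/andP; split.
  by apply: ereal_inf_lbound; exists (h y) => /=.
by apply: le_ereal_inf_tmp => _ [t /= ht <-]; rewrite lee_fin.
Qed.

Lemma support_fun_convex x y t : 0 <= t <= 1 ->
  h (t *: x + (1 - t) *: y) <= t * h x + (1 - t) * h y.
Proof.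
move=> /andP[t0 t1]; apply: support_fun_le => v Vv.
by rewrite dotDr !dotZr lerD// ler_wpM2l ?subr_ge0// support_fun_ub.
Qed.

Lemma maximizer_boundary v y : y != 0 -> V v -> dot v y = h y -> boundary V v.
Proof.
move=> y0 Vv vy; split; first exact: subset_closure.
by move=> /interior_dot_lt/(_ y0); rewrite vy ltxx.
Qed.

(** The midpoint of two maximizers would be an interior maximizer. *)
Lemma maximizer_unique v w y : strictly_convex_set V -> y != 0 ->
  V v -> dot v y = h y -> V w -> dot w y = h y -> v = w.
Proof.
move=> [_ _ sV] y0 Vv vy Vw wy; apply/eqP/negPn/negP => vw.
have bv := maximizer_boundary y0 Vv vy; have bw := maximizer_boundary y0 Vw wy.
have h2 : 0 < (2^-1 : R) < 1 by lra.
have := interior_dot_lt (sV _ _ bv bw vw _ h2) y0.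
rewrite !dotE vy wy; lra.
Qed.

(** Stability of the unique maximizer v: the points of V that differ from v in
    the direction d by at least e form a compact set avoiding v, so their
    values at y stay a fixed amount r below the maximum. *)
Lemma maximizer_gap v y d e : strictly_convex_set V -> y != 0 ->
  V v -> dot v y = h y -> 0 < e ->
  exists2 r, 0 < r & forall w, V w -> h y - r < dot w y -> `|dot w d - dot v d| < e.
Proof.
move=> sV y0 Vv vy e0.
pose far := [set w | e <= `|dot w d - dot v d|].
have cfar : closed far.
  have ct : continuous (fun w => `|dot w d - dot v d|).
    move=> w; have ctd := @dot_continuous _ _ d w.
    exact: cvg_norm (cvgB ctd (cvg_cst (dot v d))).
  by have /continuous_closedP/(_ _ (@closed_ge _ e)) := ct.
have [nVfar|Vfar] := pselect ((V `&` far) !=set0); last first.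
  exists 1 => // w Vw _; rewrite ltNge; apply/negP => wfar.
  by apply: Vfar; exists w.
have [w [Vw wfar] wmax] := compact_dot_max y (compact_closedI cV cfar) nVfar.
exists (h y - dot w y).
  rewrite subr_gt0 lt_neqAle support_fun_ub// andbT; apply/eqP => wy.
  move: wfar; rewrite /far/= (maximizer_unique sV y0 Vv vy Vw wy).
  by rewrite subrr normr0 leNgt e0.
move=> u Vu; rewrite ltNge subKr; apply: contraNlt => ufar.
exact: wmax.
Qed.

Lemma compact_dot_bounded d :
  exists2 M, 0 < M & forall v, V v -> `|dot v d| <= M.
Proof.
have := support_fun_ge0 d; have := support_fun_ge0 (- d) => h1 h2.
exists (h d + h (- d) + 1); first by lra.
move=> v Vv; have := support_fun_ub d Vv; have := support_fun_ub (- d) Vv.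
by rewrite ler_norml dotNr; lra.
Qed.

(** Danskin's theorem.  If w maximizes y + t d, then
    0 <= h (y + t d) - h y - t <v, d> <= t <w - v, d>; moreover w nearly
    maximizes y, so [maximizer_gap] makes <w - v, d> small with t. *)
Lemma support_fun_is_derive v y d : strictly_convex_set V -> y != 0 ->
  V v -> dot v y = h y -> is_derive y d h (dot v d).
Proof.
move=> sV y0 Vv vy; apply/is_derive_epsP => e e0.
have [r r0 gap] := maximizer_gap d sV y0 Vv vy e0.
have [M M0 VM] := compact_dot_bounded d.
exists (r / (2 * M)) => [|t]; first by rewrite divr_gt0// mulr_gt0.
rewrite ltr_pdivlMr ?mulr_gt0// => tr.
have [w Vw [wt _]] := support_fun_attained (y + t *: d).
have vt := support_fun_ub (y + t *: d) Vv.
have wy := support_fun_ub y Vw.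
have tB u : V u -> `|t * dot u d| <= `|t| * M.
  by move=> Vu; rewrite normrM ler_wpM2l// VM.
have wclose : `|dot w d - dot v d| < e.
  apply: gap => //.
  move: (tB _ Vw) (tB _ Vv); rewrite !ler_norml => /andP[_ ?] /andP[? _].
  move: vt; rewrite wt !dotDr !dotZr vy; lra.
have te : `|t * (dot w d - dot v d)| <= e * `|t|.
  by rewrite normrM mulrC ler_wpM2r// ltW.
apply: le_trans te; rewrite ger0_norm; last first.
  by move: vt; rewrite dotDr dotZr vy; lra.
apply: le_trans (ler_norm _).
by rewrite wt dotDr dotZr; lra.
Qed.

End SupportFunction.

(** * The gauge potential *)

Section LegendreReal.
Context {R : realType} (g : R -> R).
Hypothesis Lg : legendre (fun s : 'rV[R]_1 => (g (s ord0 ord0))%:E).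

Let edom_full : (edom (fun s : 'rV[R]_1 => (g (s ord0 ord0))%:E))° = setT.
Proof.
rewrite (_ : edom _ = setT) ?interiorT//.
by apply/seteqP; split=> // s _; rewrite /edom/= ltry.
Qed.

Lemma legendre_derivable s : derivable g s 1.
Proof.
have [_ [_ dg _ _]] := Lg.
have D : differentiable (fine \o (fun s : 'rV[R]_1 => (g (s ord0 ord0))%:E))
    (const_mx s : 'rV[R]_1) by apply: dg; rewrite edom_full.
have dl := derivableP (diff_derivable (v := const_mx 1) D).
suff : is_derive s 1 g ('D_(const_mx 1) (fine \o
    (fun s : 'rV[R]_1 => (g (s ord0 ord0))%:E)) (const_mx s)) by case.
apply/(@is_derive_lineP _ R^o); move/is_derive_lineP: dl.
set G := (X in is_derive _ _ X _ -> _); set F := (X in _ -> is_derive _ _ X _).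
by suff -> : G = F by []; apply/funext => t; rewrite /G /F/= !mxE.
Qed.

Lemma legendre_strictly_convex : strictly_convex (g : R^o -> R).
Proof.
have [_ [_ _ cg _]] := Lg; move=> s r sr t t01.
have srm : const_mx s != const_mx r :> 'rV[R]_1.
  by apply: contra sr => /eqP/rowP/(_ ord0); rewrite !mxE => ->.
have := cg (const_mx s) (const_mx r).
rewrite edom_full => /(_ I I srm _ t01).
by rewrite !mxE -!EFinM -EFinD lte_fin.
Qed.

Hypotheses (g_ge0 : forall t, 0 <= g t) (g0 : g 0 = 0).

(** Since g 0 = 0, strict convexity gives g (t r) < t (g r) for 0 < t < 1; with
    t = 1/2 and g >= 0 this shows g r > 0, and then g (t r) < g r. *)
Lemma legendre_increasing s r : 0 <= s -> s < r -> g s < g r.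
Proof.
move=> s0 sr; have r0 : 0 < r := le_lt_trans s0 sr.
have cr t : 0 < t < 1 -> g (t * r) < t * g r.
  move=> t01; have := legendre_strictly_convex (lt0r_neq0 r0) t01.
  by rewrite scaler0 addr0 g0 mulr0 addr0.
have gr : 0 < g r.
  have h2 : 0 < (2^-1 : R) < 1 by lra.
  have := le_lt_trans (g_ge0 _) (cr _ h2); lra.
have [->|sn0] := eqVneq s 0; first by rewrite g0.
have t01 : 0 < s / r < 1.
  by rewrite divr_gt0 ?ltr_pdivrMr ?mul1r// lt_neqAle eq_sym sn0.
have := cr _ t01; rewrite divfK ?gt_eqF// => /lt_trans; apply.
by move: t01 => /andP[_ t1]; rewrite gtr_pMl.
Qed.

Lemma legendre_nondecreasing s r : 0 <= s -> s <= r -> g s <= g r.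
Proof.
move=> s0; rewrite le_eqVlt => /predU1P[->//|].
by move=> /(legendre_increasing s0)/ltW.
Qed.

End LegendreReal.

Section GaugePotential.
Context {R : realType} {n : nat} (V : set 'rV[R]_n) (g : R -> R).
Hypotheses (cV : compact V) (V0 : V° 0).
Hypothesis Lg : legendre (fun s : 'rV[R]_1 => (g (s ord0 ord0))%:E).
Hypotheses (g_ge0 : forall t, 0 <= g t) (g0 : g 0 = 0).
Implicit Types (x y d v : 'rV[R]_n).

Local Notation h := (support_fun V).

(** The two points define supporting hyperplanes of V at v, hence the same one,
    {u | <x, u> = c} = {u | <y, u> = c} with c = h x > 0.  Testing this equality
    on the multiples of x and of y gives <y, x> = <x, x> and <x, y> = <y, y>,
    so x - y has length 0. *)
Lemma smooth_common_maximizer v x y : smooth_set V -> x != 0 -> y != 0 ->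
  V v -> dot v x = h x -> dot v y = h y -> h x = h y -> x = y.
Proof.
move=> [_ _ sV] x0 y0 Vv vx vy hxy.
have [H [_ Huniq]] := sV v (maximizer_boundary cV V0 x0 Vv vx).
have supp z : z != 0 -> dot v z = h z -> H = [set u | dot z u = dot z v].
  move=> z0 vz; apply: Huniq; exists z; split=> // u Vu.
  by rewrite ![dot z _]dotC vz support_fun_ub.
have E := etrans (esym (supp x x0 vx)) (supp y y0 vy).
rewrite !(dotC _ v) vx vy -hxy in E.
have hx0 := support_fun_gt0 cV V0 x0.
have same a b : a != 0 -> [set u | dot a u = h x] `<=` [set u | dot b u = h x] ->
    dot b a = dot a a.
  move=> a0 ab; have aa := dot_gt0 a0.
  have := ab ((h x / dot a a) *: a).
  rewrite /= !dotZr divfK ?gt_eqF// => /(_ erefl) ba.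
  apply: (mulfI (lt0r_neq0 (divr_gt0 hx0 aa))).
  by rewrite ba divfK ?gt_eqF.
have yx : dot y x = dot x x by apply: same; rewrite // E.
have xy : dot x y = dot y y by apply: same; rewrite // E.
apply/eqP/negPn/negP; rewrite -subr_eq0 => /dot_gt0.
by rewrite !dotE [dot x y]dotC; move: xy; rewrite dotC yx; lra.
Qed.

(** Let m be an intermediate point.  If h x != h y, strict convexity of g
    concludes.  If h x = h y, it is enough that h m < h x, and equality there
    would produce a common maximizer of x and y. *)
Lemma gauge_potential_strictly_convex : smooth_set V ->
  strictly_convex (g \o h).
Proof.
move=> sV x y xy t t01 /=; set m := _ + _.
have /andP[t0 t1] := t01.
have hm0 : 0 <= h m by exact: support_fun_ge0.
have hm : h m <= t * h x + (1 - t) * h y.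
  by apply: support_fun_convex => //; rewrite !ltW.
have [hxy|hxy] := eqVneq (h x) (h y); last first.
  apply: le_lt_trans (legendre_strictly_convex Lg hxy t01).
  exact: legendre_nondecreasing.
have hmx : h m < h x; last first.
  have := legendre_increasing Lg g_ge0 g0 hm0 hmx; rewrite -hxy; lra.
rewrite lt_neqAle; apply/andP; split; last first.
  by apply: le_trans hm _; rewrite -hxy; lra.
apply/negP => /eqP hmE.
have hx0 : h x != 0.
  apply: contra xy => /eqP hx0; have hy0 := etrans (esym hxy) hx0.
  by rewrite (support_fun_eq0 cV V0 hx0) (support_fun_eq0 cV V0 hy0).
have x0 : x != 0 by apply: contra hx0 => /eqP ->; rewrite support_fun0.
have y0 : y != 0 by apply: contra hx0 => /eqP y0; rewrite hxy y0 support_fun0.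
(* The value h x of v at m is a mean, with positive weights, of its values at x
   and y, neither of which exceeds h x; so v maximizes both x and y. *)
have [v Vv [vm _]] := support_fun_attained cV V0 m.
have vx := support_fun_ub cV V0 x Vv.
have := support_fun_ub cV V0 y Vv; rewrite -hxy => vy.
move: vm; rewrite dotDr !dotZr hmE => vm.
have t1' : 0 < 1 - t by lra.
have tvx : t * dot v x <= t * h x by rewrite ler_pM2l.
have tvy : (1 - t) * dot v y <= (1 - t) * h x by rewrite ler_pM2l.
have [vxE vyE] : dot v x = h x /\ dot v y = h x.
  split; apply/eqP; rewrite eq_le ?vx ?vy/=.
  - by rewrite -(ler_pM2l t0); lra.
  - by rewrite -(ler_pM2l t1'); lra.
rewrite hxy in vyE; move/eqP: xy; apply.
exact: smooth_common_maximizer sV x0 y0 Vv vxE vyE hxy.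
Qed.

(** Away from 0 this is the chain rule.  At 0 the gradient is 0: there h is
    bounded by a multiple of |t| along each line, and g is o(s) at 0. *)
Lemma gauge_potential_gateaux : strictly_convex_set V -> derive1 g 0 = 0 ->
  gateaux (g \o h).
Proof.
move=> sV g'0; apply: gateauxP => y.
have [->|y0] := eqVneq y 0; last first.
  have [v Vv [vy _]] := support_fun_attained cV V0 y.
  exists (derive1 g (h y) *: v) => d; rewrite dotZl.
  apply: is_derive_real_comp; first exact: legendre_derivable.
  exact: support_fun_is_derive.
exists 0 => d; rewrite dot0l; apply/is_derive_epsP => e e0.
have [M M0 VM] := compact_dot_bounded cV V0 d.
have : is_derive (0 : R) 1 g 0.
  by split; [exact: legendre_derivable|rewrite -derive1E].
move=> /is_derive_epsP/(_ (e / M))[|r r0 H]; first exact: divr_gt0.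
exists (r / M) => [|t]; first exact: divr_gt0.
rewrite ltr_pdivlMr// => tr.
have hB : h (0 + t *: d) <= `|t| * M.
  apply: support_fun_le => // v Vv; rewrite add0r dotZr.
  by apply: le_trans (ler_norm _) _; rewrite normrM ler_wpM2l// VM.
have h0 := support_fun_ge0 cV V0 (0 + t *: d).
rewrite /= support_fun0// g0 mulr0 !subr0.
have /H : `|h (0 + t *: d)| < r by rewrite ger0_norm//; exact: le_lt_trans tr.
rewrite add0r [_ *: 1]mulr1 g0 mulr0 !subr0 => /le_trans; apply.
rewrite (ger0_norm h0) mulrAC ler_pdivrMr// -mulrA ler_wpM2l//.
exact: ltW.
Qed.

End GaugePotential.

Theorem proposition1 (R : realType) (n : nat) (X : set 'rV[R]_n)
    (a0 : 'rV[R]_n) (V : set 'rV[R]_n) (g : R -> R) (phi : 'rV[R]_n -> R)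
    (x0 : 'rV[R]_n) (lambda : nat -> R) (x : nat -> 'rV[R]_n)
    (xCP : R -> 'rV[R]_n) (K : nat)
    (hX : polyhedron X) (hX0 : X !=set0)
    (hVcompact : compact V) (hVsmooth : smooth_set V)
    (hVstrict : strictly_convex_set V) (hV0 : V° 0)
    (hg_ge0 : forall t : R, 0 <= g t)
    (hg_legendre : legendre (fun s : 'rV[R]_1 => (g (s ord0 ord0))%:E))
    (hg0 : g 0 = 0) (hg'0 : derive1 g 0 = 0)
    (hphi : forall y, phi y = g (fine (set_gauge (polar V) y)))
    (hx0 : X x0)
    (hlambda_gt0 : forall k, 0 < lambda k)
    (hlambda_div : (fun N : nat => \sum_(0 <= k < N) (lambda k)^-1) @ \oo --> +oo)
    (hprox : proximal_path X a0 phi lambda x0 x)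
    (hcentral : central_path X a0 phi x0 xCP)
    (hK : (1 <= K)%N)
    (hC : monotone_path X K x \/ affine_subspace X \/ X = setT) :
  forall k : nat, (k <= K)%N ->
    x k.+1 = xCP (\sum_(0 <= i < k.+1) (lambda i)^-1)^-1.
Proof.
move=> k kK.
have phiE : phi = g \o support_fun V.
  by apply/funext => y; rewrite hphi set_gauge_polar.
have cphi : strictly_convex phi.
  by rewrite phiE; exact: gauge_potential_strictly_convex.
have dphi : gateaux phi by rewrite phiE; exact: gauge_potential_gateaux.
have convX := polyhedron_convex hX.
have [x0E xS] := hprox; rewrite -x0E in hprox hcentral.
have Xx i : X (x i) by case: i => [|i]; [rewrite x0E|exact: (xS i).1].
have mono : monotone_path X K x.
  case: hC => [//|[|]] affX; apply: affine_monotone => //.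
  by rewrite affX; exact: setT_affine.
apply: (argmin_unique convX cphi (omega_gt0 hlambda_gt0 k)).
  exact: monotone_prox_central mono kK.
exact/hcentral/omega_gt0.
Qed.
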